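(* Let $n$ be a nonnegative integer and let $a,b,c$ be complex numbers such that no lower parameter of the series below is a nonpositive integer and all denominators below are nonzero. Then $$\frac{c+a+bn}{c+a}\,\frac{(c+a)_n}{(c)_n}=\frac{c+bn}{c}\;{}_5F_4\left[\begin{matrix}-\frac n2,\ \frac{1-n}{2},\ 1+\frac{c+bn}{1-2b},\ -a,\ a+1\\ \frac12,\ \frac{c+bn}{1-2b},\ c+1,\ 1-c-n\end{matrix};1\right]$$ $$+\frac{na(bn-b+c)}{c(c-1+n)}\;{}_5F_4\left[\begin{matrix}\frac{1-n}{2},\ \frac{2-n}{2},\ 1+\frac{c+bn-b}{1-2b},\ 1-a,\ a+1\\ \frac32,\ \frac{c+bn-b}{1-2b},\ c+1,\ 2-c-n\end{matrix};1\right].$$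
   Context: $(x)_0=1$ and $(x)_n=x(x+1)\cdots(x+n-1)$ for $n\ge1$. The generalized hypergeometric series is ${}_pF_q\left[\begin{matrix}a_1,\dots,a_p\\ b_1,\dots,b_q\end{matrix};z\right]=\sum_{k\ge0}\frac{(a_1)_k\cdots(a_p)_k}{(b_1)_k\cdots(b_q)_k}\frac{z^k}{k!}$, with lower parameters $b_j\in\mathbb{C}\setminus\mathbb{Z}_{\le0}$. The series involved terminate; a term whose coefficient vanishes because of the factor $n$ (when $n=0$) is read as $0$. *)

(* Defs.v *)
From HB Require Import structures.
From mathcomp Require Import all_boot all_order all_algebra.
From mathcomp Require Import all_classical all_reals all_analysis.
From mathcomp Require Import complex.

Set Implicit Arguments.
Unset Strict Implicit.
Unset Printing Implicit Defensive.

Import Order.TTheory GRing.Theory Num.Theory.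
Import numFieldNormedType.Exports.

Local Open Scope ring_scope.
Local Open Scope complex_scope.

Definition pochhammer (R : realType) (x : R[i]) (n : nat) : R[i] :=
  \prod_(i < n) (x + i%:R).

Definition hypergeometric_term (R : realType) (us ls : seq R[i]) (z : R[i])
    (k : nat) : R[i] :=
  (\prod_(u <- us) pochhammer u k) / (\prod_(l <- ls) pochhammer l k)
  * (z ^+ k / k`!%:R).

(* The size us F size ls series with upper parameters us and lower parameters
   ls. R[i]^o carries the norm topology of R[i], which R[i] itself lacks here.
   [limn] is total: the value is unspecified if the series diverges. *)
Definition hypergeometric (R : realType) (us ls : seq R[i]) (z : R[i]) : R[i] :=
  limn (series (hypergeometric_term us ls z) : nat -> R[i]^o).

Definition nonpos_integer (R : realType) (x : R[i]) : Prop :=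
  exists m : nat, x = - m%:R.

(* Main.v *)
Require Import Defs.
From HB Require Import structures.
From mathcomp Require Import all_boot all_order all_algebra.
From mathcomp Require Import all_classical all_reals all_analysis.
From mathcomp Require Import complex ring zify.
Import Order.TTheory GRing.Theory Num.Theory.
Import numFieldNormedType.Exports.
Local Open Scope ring_scope.
Local Open Scope complex_scope.

(** Write [(x)_m] for the rising factorial and put
    [P_j(a) = (a - ceil(j/2) + 1)_j], the product of the [j] consecutive
    factors around [a] that occur in Gauss's central-difference form of
    Newton interpolation. The theorem is that interpolation formula in
    disguise.

    The terms with index [k] of the first and of the second series, multiplied
    by their prefactors, are the terms [j = 2k] and [j = 2k + 1] of one sum.
    Indeed the parameters in [n / 2] combine with [1/2] or [3/2] and with [k!]
    into [C(n, j)] (duplication formula, [binomial_even] and [binomial_odd]);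
    the parameters in [- a] and [a + 1] produce [P_j(a)] ([central_double] and
    [central_doubleS]); reflecting the lower parameter that contains [- n]
    leaves [(c)_(n - ceil(j/2)) / (c)_n]; and the pair of parameters
    [1 + z], [z] only contributes the linear factor
    [c + floor(j/2) + b (n - j)] ([rising_shift_ratio]). Both series together
    are therefore
      [sum_j C(n, j) P_j(a) (c + floor(j/2) + b (n - j))
             (c)_(n - ceil(j/2)) / (c)_(floor(j/2) + 1)],
    divided by [(c)_n].

    This is affine in [b], and so is the left-hand side, since
    [(c + a + b n) / (c + a) (c + a)_n = (c + a)_n + b n (c + a + 1)_(n - 1)].
    The constant coefficients agree by
      [(c + a)_n = sum_j C(n, j) P_j(a) (c + floor(j/2))_(n - j)]
    ([gauss_interpolation]), and the coefficients of [b] agree by the same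
    identity for [c + 1] and [n - 1] ([gauss_interpolation_pred]).

    The interpolation identity holds in every commutative ring, by induction
    on [n]: multiplying the [j]-th term by [c + a + n] gives the two
    contributions that Pascal's rule requires, up to a defect that telescopes
    in [j]. *)

(** * Rising factorials over a commutative ring *)

Section Rising.
Context {A : comNzRingType}.
Implicit Types (a c x y : A) (j k m n : nat).

Definition rising x n : A := \prod_(i < n) (x + i%:R).

Lemma rising0 x : rising x 0 = 1.
Proof. by rewrite /rising big_ord0. Qed.

Lemma risingSr x n : rising x n.+1 = rising x n * (x + n%:R).
Proof. by rewrite /rising big_ord_recr. Qed.

Lemma risingD x m n : rising x (m + n) = rising x m * rising (x + m%:R) n.
Proof.
elim: n => [|n IHn]; first by rewrite addn0 rising0 mulr1.
by rewrite addnS !risingSr IHn natrD addrA mulrA.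
Qed.

Lemma risingS x n : rising x n.+1 = x * rising (x + 1) n.
Proof. by rewrite -add1n risingD risingSr rising0 mul1r addr0. Qed.

Lemma rising_reflect x n : rising (1 - x) n = (-1) ^+ n * rising (x - n%:R) n.
Proof.
elim: n => [|n IHn]; first by rewrite !rising0 expr0 mulr1.
rewrite risingSr IHn risingS exprS -natr1.
have -> : x - (n%:R + 1) + 1 = x - n%:R by ring.
ring.
Qed.

Lemma rising1 n : rising 1 n = n`!%:R.
Proof.
elim: n => [|n IHn]; first by rewrite rising0.
by rewrite risingSr IHn nat1r factS mulnC natrM.
Qed.

Lemma risingN n m : rising (- n%:R) m = (-1) ^+ m * (n ^_ m)%:R.
Proof.
elim: m => [|m IHm]; first by rewrite rising0 expr0 mulr1.
rewrite risingSr IHm ffactnSr natrM exprS.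
have [le_mn|lt_nm] := leqP m n; first by rewrite natrB //; ring.
by rewrite ffact_small // !(mulr0, mul0r).
Qed.

(** * Gauss interpolation of the rising factorial *)

Definition central a j : A := rising (a - (uphalf j)%:R + 1) j.

Lemma central0 a : central a 0 = 1.
Proof. exact: rising0. Qed.

Lemma central_odd a k : central a k.*2.+1 = central a k.*2 * (a - k%:R).
Proof.
rewrite /central /= uphalf_double doubleK risingS -natr1.
have -> : a - (k%:R + 1) + 1 = a - k%:R by ring.
by rewrite mulrC.
Qed.

Lemma central_even a k :
  central a k.+1.*2 = central a k.*2.+1 * (a + k.+1%:R).
Proof.
rewrite /central doubleS /= uphalf_double doubleK risingSr.
by congr (_ * _); rewrite -!natr1 -addnn natrD; ring.
Qed.

(** The split [c + a + m = (c + k + m - 2k) + (a - k) + 2k]: the first summand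
    prolongs the rising factorial, the second the central product, and the
    third is the defect. *)
Lemma gauss_step_even a c k m : (k.*2 <= m)%N ->
  central a k.*2 * rising (c + k%:R) (m - k.*2) * (c + a + m%:R) =
  central a k.*2 * rising (c + k%:R) (m - k.*2).+1
  + central a k.*2.+1 * rising (c + k%:R) (m - k.*2)
  + k.*2%:R * (central a k.*2 * rising (c + k%:R) (m - k.*2)).
Proof.
move=> le_km; rewrite central_odd risingSr natrB // -addnn natrD; ring.
Qed.

(** Here [c + a + m = (c + k + m - 2k - 1) + (a + k + 1)] prolongs both
    products exactly, but the rising factorial multiplying the new central
    product starts at [c + k] instead of [c + k + 1]; the defect is this
    difference. *)
Lemma gauss_step_odd a c k m : (k.*2 < m)%N ->
  central a k.*2.+1 * rising (c + k%:R) (m - k.*2.+1) * (c + a + m%:R) =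
  central a k.*2.+1 * rising (c + k%:R) (m - k.*2.+1).+1
  + central a k.+1.*2 * rising (c + k.+1%:R) (m - k.*2.+1)
  - (m - k.*2.+1)%:R
    * (central a k.+1.*2 * rising (c + k.+1%:R) (m - k.*2.+1).-1).
Proof.
move=> lt_km; rewrite central_even.
have -> : c + a + m%:R
    = (c + k%:R + (m - k.*2.+1)%:R) + (a + k.+1%:R).
  by rewrite natrB // -!natr1 -addnn natrD; ring.
rewrite [rising _ _.+1]risingSr.
case: (m - k.*2.+1)%N => [|d] /=; first by rewrite !rising0; ring.
have -> : c + k.+1%:R = c + k%:R + 1 :> A by rewrite -natr1 addrA.
rewrite risingS risingSr -!natr1; ring.
Qed.

Definition gauss_term a c n j : A :=
  'C(n, j)%:R * (central a j * rising (c + j./2%:R) (n - j)).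

(** The defect of an even index [j]; that of the odd index [j - 1] is its
    opposite, which is why the value at odd indices is taken to be [0]. *)
Definition gauss_defect a c n j : A :=
  if odd j then 0 else j%:R * gauss_term a c n j.

(** The odd case turns [C(n, j) (n - j)] into [C(n, j + 1) (j + 1)], so that the
    two kinds of defect become consecutive differences of one sequence. *)
Lemma gauss_term_step a c n j : (j <= n)%N ->
  gauss_term a c n j * (c + a + n%:R) =
  'C(n, j)%:R * (central a j * rising (c + j./2%:R) (n.+1 - j))
  + 'C(n, j)%:R * (central a j.+1 * rising (c + j.+1./2%:R) (n - j))
  + (gauss_defect a c n j - gauss_defect a c n j.+1).
Proof.
move=> le_jn; rewrite /gauss_defect /gauss_term subSn //= -mulrA.
have [j_odd|j_even] := boolP (odd j); last first.
  have [k def_j] : exists k, j = k.*2.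
    by exists j./2; rewrite -[LHS]odd_double_half (negPf j_even).
  rewrite def_j uphalf_double doubleK in le_jn *.
  by rewrite gauss_step_even //=; ring.
have [k def_j] : exists k, j = k.*2.+1.
  by exists j./2; rewrite -[LHS]odd_double_half j_odd.
rewrite def_j /= uphalf_double doubleK -doubleS in le_jn *.
rewrite gauss_step_odd //= sub0r.
have -> : (n - k.+1.*2 = (n - k.*2.+1).-1)%N by rewrite doubleS -subnS.
have := congr1 (fun i => i%:R : A) (mul_bin_left n k.*2.+1).
rewrite !natrM -doubleS => E.
by rewrite [k.+1.*2%:R * _]mulrA E; ring.
Qed.

(** Multiply the formula for [n] by [c + a + n] and sum [gauss_term_step]: the
    defects telescope to the values at [0] and [n + 1], where the factor [j]
    and the binomial coefficient vanish, and Pascal's rule collects the rest. *)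
Lemma gauss_interpolation a c n :
  rising (c + a) n = \sum_(j < n.+1) gauss_term a c n j.
Proof.
elim: n => [|n IHn].
  by rewrite big_ord1 /gauss_term central0 !rising0 bin0 !mulr1.
rewrite risingSr IHn mulr_suml.
under eq_bigr => j _ do rewrite gauss_term_step -1?ltnS //.
rewrite big_split /=.
have -> : \sum_(j < n.+1) (gauss_defect a c n j - gauss_defect a c n j.+1) = 0.
  rewrite -(big_mkord xpredT
    (fun j => gauss_defect a c n j - gauss_defect a c n j.+1)).
  under eq_bigr => j _ do rewrite -opprB.
  rewrite sumrN telescope_sumr // /gauss_defect /gauss_term bin_small //=.
  by rewrite !mul0r mulr0 if_same subrr oppr0.
rewrite addr0 big_split [in RHS]big_ord_recl /= [in LHS]big_ord_recl /= -addrA.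
congr (_ + _); first by rewrite /gauss_term !bin0.
rewrite /gauss_term.
under [in RHS]eq_bigr => j _ do rewrite /bump add1n binS natrD mulrDl subSS.
rewrite big_split /=; congr (_ + _).
rewrite [in RHS]big_ord_recr /= bin_small // mul0r addr0.
by apply: eq_bigr => j _; rewrite /bump add1n subSS.
Qed.

(** [gauss_interpolation] at [c + 1] and [n - 1], with
    [n C(n - 1, j) = (n - j) C(n, j)]; this is the coefficient of [b] in
    [gauss_interpolation_linear]. *)
Lemma gauss_interpolation_pred a c n :
  n%:R * rising (c + a + 1) n.-1 =
  \sum_(j < n.+1) 'C(n, j)%:R
    * (central a j * ((n - j)%:R * rising (c + 1 + j./2%:R) (n - j).-1)).
Proof.
case: n => [|n]; first by rewrite big_ord1 subnn !(mul0r, mulr0).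
rewrite big_ord_recr /= subnn mul0r !mulr0 addr0 addrAC gauss_interpolation.
rewrite mulr_sumr; apply: eq_bigr => j _.
have le_jn : (j <= n)%N by rewrite -ltnS.
have := congr1 (fun i => i%:R : A) (mul_bin_down n.+1 j).
rewrite !natrM /gauss_term subSn //= => E.
rewrite mulrA E; ring.
Qed.

(** * Reduction of the hypergeometric parameters *)

Lemma central_double a k :
  (-1) ^+ k * (rising (- a) k * rising (a + 1) k) = central a k.*2.
Proof.
have -> : - a = 1 - (a + 1) by ring.
rewrite rising_reflect /central uphalf_double -addnn risingD !mulrA -expr2.
rewrite sqrr_sign mul1r.
congr (rising _ _ * rising _ _); first by rewrite addrAC.
by rewrite addrAC subrK.
Qed.

Lemma central_doubleS a k :
  (-1) ^+ k * (a * (rising (1 - a) k * rising (a + 1) k)) = central a k.*2.+1.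
Proof.
rewrite rising_reflect /central /= doubleK -addnn -addnS risingD risingS -natr1.
have -> : a - (k%:R + 1) + 1 = a - k%:R by ring.
have -> : a - k%:R + k%:R = a by ring.
by rewrite -!mulrA [a * _]mulrCA [LHS]mulrA -expr2 sqrr_sign mul1r mulrCA.
Qed.

(** Reflection makes [(1 - c - n)_k] the last [k] factors of [(c)_n], up to
    sign. *)
Lemma rising_lower_even c n k : (k <= n)%N ->
  rising (1 - c - n%:R) k * rising c (n - k) = (-1) ^+ k * rising c n.
Proof.
move=> le_kn; rewrite -(subnK le_kn) risingD addnK.
have -> : 1 - c - (n - k + k)%:R = 1 - (c + (n - k)%:R + k%:R).
  by rewrite natrD; ring.
by rewrite rising_reflect addrK mulrAC mulrA.
Qed.

(** As [rising_lower_even]; the prefactor [c - 1 + n] supplies the last factor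
    of [(c)_n]. *)
Lemma rising_lower_odd c n k : (k < n)%N ->
  (c - 1 + n%:R) * rising (2 - c - n%:R) k * rising c (n - k.+1) =
  (-1) ^+ k * rising c n.
Proof.
move=> lt_kn; rewrite -{1 2 4}(subnK lt_kn) risingD risingSr.
have -> : 2 - c - (n - k.+1 + k.+1)%:R = 1 - (c + (n - k.+1)%:R + k%:R).
  by rewrite natrD -natr1; ring.
rewrite rising_reflect addrK natrD -natr1; ring.
Qed.

End Rising.

Section Field.
Context {F : numFieldType}.
Implicit Types (a b c d u v w x y : F) (j k m n : nat).

Lemma rising_duplication x k :
  4 ^+ k * (rising x k * rising (x + 1 / 2) k) = rising (2 * x) k.*2.
Proof.
elim: k => [|k IHk]; first by rewrite !rising0 !mulr1.
rewrite doubleS [RHS]risingSr [rising (2 * x) _.+1]risingSr -IHk exprS.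
by rewrite !risingSr -natr1 -addnn natrD; field.
Qed.

(** By duplication the numerator is [(- n)_2k] and the denominator [(2k)!], both
    divided by [4 ^ k]. *)
Lemma binomial_even n k :
  rising (- (n%:R / 2)) k * rising ((1 - n%:R) / 2) k
    / (rising (1 / 2) k * k`!%:R) = 'C(n, k.*2)%:R :> F.
Proof.
have scale u v : u / v = (4 ^+ k * u) / (4 ^+ k * v).
  by rewrite -mulf_div divff ?mul1r // expf_neq0 // pnatr_eq0.
have fact_neq0 : k.*2`!%:R != 0 :> F by rewrite pnatr_eq0 -lt0n fact_gt0.
rewrite scale -rising1.
have -> : (1 - n%:R) / 2 = - (n%:R / 2) + 1 / 2 :> F by field.
have -> : rising 1 k = rising (1 / 2 + 1 / 2) k :> F.
  by congr rising; field.
rewrite !rising_duplication.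
have -> : 2 * - (n%:R / 2) = - n%:R :> F by field.
have -> : 2 * (1 / 2) = 1 :> F by field.
rewrite risingN rising1 -signr_odd odd_double mul1r -bin_ffact natrM mulfK //.
Qed.

(** By duplication the numerator is [(1 - n)_2k], which [n] completes to
    [- (- n)_(2k+1)], and the denominator is [(2)_2k = (2k+1)!], both divided
    by [4 ^ k]. *)
Lemma binomial_odd n k :
  n%:R * (rising ((1 - n%:R) / 2) k * rising ((2 - n%:R) / 2) k
    / (rising (3 / 2) k * k`!%:R)) = 'C(n, k.*2.+1)%:R :> F.
Proof.
have scale u v : u / v = (4 ^+ k * u) / (4 ^+ k * v).
  by rewrite -mulf_div divff ?mul1r // expf_neq0 // pnatr_eq0.
have fact_neq0 : k.*2.+1`!%:R != 0 :> F by rewrite pnatr_eq0 -lt0n fact_gt0.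
rewrite [X in _ * X]scale -rising1.
have -> : (2 - n%:R) / 2 = (1 - n%:R) / 2 + 1 / 2 :> F by field.
have -> : 3 / 2 = 1 + 1 / 2 :> F by field.
rewrite (mulrC (rising (1 + _) k)) !rising_duplication.
have -> : 2 * ((1 - n%:R) / 2) = - n%:R + 1 :> F by field.
have -> : 2 * 1 = 1 + 1 :> F by ring.
rewrite -[rising (1 + 1) _]mul1r -risingS rising1 mulrA.
have -> m : n%:R * rising (- n%:R + 1) m = - rising (- n%:R) m.+1 :> F.
  by rewrite risingS mulNr opprK.
rewrite risingN -signr_odd /= odd_double mulN1r opprK.
by rewrite -bin_ffact natrM mulfK.
Qed.

(** The common value, up to the factor [1 / (c)_n], of the prefactored terms of
    both series: even [j] give the first series and odd [j] the second. *)
Definition gauss_weight a b c n j : F :=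
  'C(n, j)%:R * (central a j
     * ((c + j./2%:R + b * (n - j)%:R)
        * (rising c (n - uphalf j) / rising c j./2.+1))).

(** The target identity with both series merged. The affine factor splits as
    [c + floor(j/2)], which completes the quotient to the term of
    [gauss_interpolation], and [b (n - j)], which gives that of
    [gauss_interpolation_pred]. *)
Lemma gauss_interpolation_linear a b c n : c + a != 0 ->
  (forall k, rising c k != 0) ->
  (c + a + b * n%:R) / (c + a) * rising (c + a) n =
  \sum_(j < n.+1) gauss_weight a b c n j.
Proof.
move=> ca_neq0 rc_neq0.
have -> : (c + a + b * n%:R) / (c + a) * rising (c + a) n =
    rising (c + a) n + b * (n%:R * rising (c + a + 1) n.-1).
  case: n => [|n] /=; last by rewrite risingS; field.
  by rewrite rising0; field.
rewrite gauss_interpolation gauss_interpolation_pred mulr_sumr -big_split /=.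
apply: eq_bigr => j _; rewrite /gauss_weight.
have le_jn : (j <= n)%N by rewrite -ltnS.
have -> : (n - uphalf j = j./2 + (n - j))%N.
  have := odd_double_half j; rewrite uphalf_half -addnn; lia.
(* The quotient is (c + k + 1)_(n - j - 1) for j < n, where k = j./2; for j = n
   it is 1 / (c + k), which the linear factor then cancels. *)
have := rc_neq0 j./2.+1; rewrite risingD risingSr mulf_eq0 => /norP[h1 h2].
rewrite /gauss_term.
case: (n - j)%N => [|d] /=; first by rewrite rising0; field; rewrite h1 h2.
rewrite risingS.
have -> : c + 1 + j./2%:R = c + j./2%:R + 1 by ring.
by field; rewrite h1 h2.
Qed.

(** The two products telescope: [(1 + z)_k / (z)_k = (z + k) / z]. Keeping the
    factor [w] on the left avoids dividing by it. *)
Lemma rising_shift_ratio w d k : d != 0 -> rising (w / d) k != 0 ->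
  w * (rising (1 + w / d) k / rising (w / d) k) = w + k%:R * d.
Proof.
move=> d_neq0 r_neq0; rewrite mulrA addrC.
have -> : w * rising (w / d + 1) k = (w + k%:R * d) * rising (w / d) k.
  have -> : (w + k%:R * d) * rising (w / d) k
      = d * (rising (w / d) k * (w / d + k%:R)) by field.
  by rewrite -risingSr risingS; field.
by rewrite mulfK.
Qed.

Lemma inv_of_signed_mul x y w k : w != 0 -> x * y = (-1) ^+ k * w ->
  x^-1 = (-1) ^+ k * y / w.
Proof.
move=> w_neq0 xy; apply: mulr1_eq.
by rewrite mulrA mulrCA xy mulrA -expr2 sqrr_sign mul1r divff.
Qed.

Lemma gauss_weight_even a b c n k :
  1 - 2 * b != 0 -> rising c n != 0 ->
  rising ((c + b * n%:R) / (1 - 2 * b)) k != 0 ->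
  (c + b * n%:R) / c *
  ((rising (- (n%:R / 2)) k * (rising ((1 - n%:R) / 2) k *
     (rising (1 + (c + b * n%:R) / (1 - 2 * b)) k *
       (rising (- a) k * rising (a + 1) k)))) /
   (rising (1 / 2) k * (rising ((c + b * n%:R) / (1 - 2 * b)) k *
     (rising (c + 1) k * rising (1 - c - n%:R) k))) / k`!%:R) =
  gauss_weight a b c n k.*2 / rising c n.
Proof.
move=> d_neq0 rcn_neq0 rz_neq0.
set z := (c + b * n%:R) / (1 - 2 * b) in rz_neq0 *.
(* Group the parameters into the four independent ratios. *)
transitivity ('C(n, k.*2)%:R
   * ((c + b * n%:R) * (rising (1 + z) k / rising z k))
   * ((rising (- a) k * rising (a + 1) k) / rising (1 - c - n%:R) k)
   / rising c k.+1).
  by rewrite -binomial_even risingS !invfM; ring.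
rewrite rising_shift_ratio // /gauss_weight uphalf_double doubleK.
have [le_kn|lt_nk] := leqP k.*2 n; last by rewrite bin_small // !mul0r.
have le_kn' : (k <= n)%N by rewrite (leq_trans _ le_kn) // -addnn leq_addr.
rewrite (inv_of_signed_mul _ _ _ _ rcn_neq0 (rising_lower_even c n k le_kn')).
rewrite -central_double.
have -> : c + k%:R + b * (n - k.*2)%:R = c + b * n%:R + k%:R * (1 - 2 * b).
  by rewrite natrB // -addnn natrD; ring.
ring.
Qed.

Lemma gauss_weight_odd a b c n k :
  1 - 2 * b != 0 -> rising c n != 0 ->
  rising ((c + b * n%:R - b) / (1 - 2 * b)) k != 0 ->
  n%:R * a * (b * n%:R - b + c) / (c * (c - 1 + n%:R)) *
  ((rising ((1 - n%:R) / 2) k * (rising ((2 - n%:R) / 2) k *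
     (rising (1 + (c + b * n%:R - b) / (1 - 2 * b)) k *
       (rising (1 - a) k * rising (a + 1) k)))) /
   (rising (3 / 2) k * (rising ((c + b * n%:R - b) / (1 - 2 * b)) k *
     (rising (c + 1) k * rising (2 - c - n%:R) k))) / k`!%:R) =
  gauss_weight a b c n k.*2.+1 / rising c n.
Proof.
move=> d_neq0 rcn_neq0 rz_neq0.
set z := (c + b * n%:R - b) / (1 - 2 * b) in rz_neq0 *.
transitivity ('C(n, k.*2.+1)%:R
   * ((c + b * n%:R - b) * (rising (1 + z) k / rising z k))
   * (a * (rising (1 - a) k * rising (a + 1) k)
      / ((c - 1 + n%:R) * rising (2 - c - n%:R) k)) / rising c k.+1).
  by rewrite -binomial_odd risingS !invfM; ring.
rewrite rising_shift_ratio // /gauss_weight /= uphalf_double doubleK.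
have [lt_kn|le_nk] := ltnP k.*2 n; last by rewrite bin_small // !mul0r.
have lt_kn' : (k < n)%N by rewrite (leq_ltn_trans _ lt_kn) // -addnn leq_addr.
rewrite (inv_of_signed_mul _ _ _ _ rcn_neq0 (rising_lower_odd c n k lt_kn')).
rewrite -central_doubleS.
have -> : c + k%:R + b * (n - k.*2.+1)%:R
    = c + b * n%:R - b + k%:R * (1 - 2 * b).
  by rewrite natrB // -natr1 -addnn natrD; ring.
ring.
Qed.

End Field.

(** * Terminating series *)

Section Series.
Context {R : realType}.
Implicit Types (x z : R[i]) (us ls : seq R[i]) (k N : nat).

Lemma pochhammerE x k : pochhammer x k = rising x k.
Proof. by []. Qed.

Lemma rising_neq0 x k : ~ nonpos_integer x -> rising x k != 0.
Proof.
move=> x_lower; apply/prodf_neq0 => i _.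
by apply/eqP => /eqP; rewrite addr_eq0 => /eqP x_eq; apply: x_lower; exists i.
Qed.

Lemma hypergeometric_finite us ls z N :
  (forall k, (N <= k)%N -> hypergeometric_term us ls z k = 0) ->
  hypergeometric us ls z = \sum_(k < N) hypergeometric_term us ls z k.
Proof.
move=> term0; rewrite /hypergeometric.
apply: (@lim_near_cst R[i]^o); first exact: norm_hausdorff.
exists N => // M /= le_NM; rewrite /series /=.
rewrite (big_cat_nat (leq0n N) le_NM) /= -[RHS]addr0 big_mkord; congr (_ + _).
by rewrite big_nat big1 // => k /andP[le_Nk _]; apply: term0.
Qed.

(** A series need not terminate when its prefactor [s] vanishes, as the second
    one for [n = 0]; imposing termination on the prefactored terms [v] covers
    this case too. *)
Lemma scaled_hypergeometric_finite us ls z N (s : R[i]) (v : nat -> R[i]) :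
  (forall k, s * hypergeometric_term us ls z k = v k) ->
  (forall k, (N <= k)%N -> v k = 0) ->
  s * hypergeometric us ls z = \sum_(k < N) v k.
Proof.
move=> sE v0; have [s0|s_neq0] := eqVneq s 0.
  by rewrite s0 mul0r big1 // => k _; rewrite -sE s0 mul0r.
rewrite (@hypergeometric_finite us ls z N) ?mulr_sumr //.
  by apply: eq_bigr => k _; apply: sE.
by move=> k le_Nk; apply: (mulfI s_neq0); rewrite sE mulr0 v0.
Qed.

End Series.

Lemma sum_even_odd (V : nmodType) (w : nat -> V) N :
  \sum_(k < N) w k.*2 + \sum_(k < N) w k.*2.+1 = \sum_(j < N.*2) w j.
Proof.
elim: N => [|N IHN]; first by rewrite !big_ord0 addr0.
by rewrite doubleS !big_ord_recr /= -IHN addrACA addrA.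
Qed.

Theorem theorem5p1 (R : realType) (n : nat) (a b c : R[i])
  (one_sub_2b_neq0 : 1 - 2 * b != 0)
  (ca_neq0 : c + a != 0)
  (c_neq0 : c != 0)
  (c1n_neq0 : c - 1 + n%:R != 0)
  (poch_neq0 : pochhammer c n != 0)
  (lower1 : forall l : R[i],
     l \in [:: 1 / 2; (c + b * n%:R) / (1 - 2 * b); c + 1; 1 - c - n%:R] ->
     ~ nonpos_integer l)
  (lower2 : forall l : R[i],
     l \in [:: 3 / 2; (c + b * n%:R - b) / (1 - 2 * b); c + 1; 2 - c - n%:R] ->
     ~ nonpos_integer l) :
  (c + a + b * n%:R) / (c + a) * (pochhammer (c + a) n / pochhammer c n) =
  (c + b * n%:R) / c *
    hypergeometric
      [:: - (n%:R / 2); (1 - n%:R) / 2; 1 + (c + b * n%:R) / (1 - 2 * b);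
          - a; a + 1]
      [:: 1 / 2; (c + b * n%:R) / (1 - 2 * b); c + 1; 1 - c - n%:R]
      1
  + n%:R * a * (b * n%:R - b + c) / (c * (c - 1 + n%:R)) *
    hypergeometric
      [:: (1 - n%:R) / 2; (2 - n%:R) / 2;
          1 + (c + b * n%:R - b) / (1 - 2 * b); 1 - a; a + 1]
      [:: 3 / 2; (c + b * n%:R - b) / (1 - 2 * b); c + 1; 2 - c - n%:R]
      1.
Proof.
have c1_lower : ~ nonpos_integer (c + 1).
  by apply: lower1; rewrite !inE eqxx !orbT.
have rc_neq0 k : rising c k != 0.
  case: k => [|k]; first by rewrite rising0 oner_neq0.
  by rewrite risingS mulf_neq0 // rising_neq0.
have weight_gt j : (n < j)%N -> gauss_weight a b c n j / rising c n = 0.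
  by move=> lt_nj; rewrite /gauss_weight bin_small // !mul0r.
rewrite (@scaled_hypergeometric_finite R _ _ _ n.+1 _
  (fun k => gauss_weight a b c n k.*2 / rising c n)); last 2 first.
- move=> k.
  rewrite -gauss_weight_even //; last first.
    by apply/rising_neq0/lower1; rewrite !inE eqxx !orbT.
  rewrite /hypergeometric_term !big_cons !big_nil expr1n !mulr1 !pochhammerE.
  by rewrite [1 / k`!%:R]mul1r.
- move=> k lt_nk; apply: weight_gt.
  by rewrite (leq_trans lt_nk) // -addnn leq_addr.
rewrite (@scaled_hypergeometric_finite R _ _ _ n.+1 _
  (fun k => gauss_weight a b c n k.*2.+1 / rising c n)); last 2 first.
- move=> k.
  rewrite -gauss_weight_odd //; last first.
    by apply/rising_neq0/lower2; rewrite !inE eqxx !orbT.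
  rewrite /hypergeometric_term !big_cons !big_nil expr1n !mulr1 !pochhammerE.
  by rewrite [1 / k`!%:R]mul1r.
- move=> k lt_nk; apply: weight_gt.
  by rewrite (leq_trans lt_nk) // -addnn ltnW // ltnS leq_addr.
rewrite (sum_even_odd _ (fun j => gauss_weight a b c n j / rising c n)).
(* The even-odd sum runs to 2n + 1; the weights beyond n vanish. *)
rewrite -addnn big_split_ord /= [X in _ = _ + X]big1 ?addr0; last first.
  by move=> k _; apply: weight_gt; rewrite leq_addr.
by rewrite -mulr_suml -gauss_interpolation_linear // mulrA.
Qed.
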